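(* Let $\mathfrak{B}$ be a Bol algebra of dimension 3 with trilinear operation of Type III$^+$ whose canonical enveloping Lie algebra has dimension 4. Then $\mathfrak{B}$ is isomorphic to one of the following Bol algebras with basis $e_1,e_2,e_3$, in each of which $(e_1,e_2,e_2)=-e_1$ (all operations on basis vectors not listed, and not following by skew-symmetry in the first two arguments, are zero): (i) $e_1\cdot e_2=-e_2$; (ii) $e_1\cdot e_2=-xe_1$, with $x\in\mathbb{R}$, $x\ge0$; (iii) $e_1\cdot e_2=-xe_1-e_3$, with $x\in\mathbb{R}$, $x\ge0$. Moreover, the listed Bol algebras are pairwise non-isomorphic.
   Context: A Bol algebra is a finite-dimensional real vector space $\mathfrak{B}$ with a bilinear operation $x\cdot y$ and a trilinear operation $(x,y,z)$ such that for all elements: $x\cdot x=0$; $(x,x,y)=0$; $(x,y,z)+(y,z,x)+(z,x,y)=0$; $(x,y,(z,\xi,\eta))=((x,y,z),\xi,\eta)+(z,(x,y,\xi),\eta)+(z,\xi,(x,y,\eta))$; $(x,y,z)\cdot\xi-(x,y,\xi)\cdot z+(z,\xi,x\cdot y)-(x,y,z\cdot\xi)+(x\cdot y)\cdot(z\cdot\xi)=0$. An isomorphism of Bol algebras is a linear bijection preserving both operations. Type III$^+$: the trilinear operation is of Type III$^+$ if in some basis $e_1,e_2,e_3$ of $\mathfrak{B}$ it is given by $(e_1,e_2,e_2)=-e_1=-(e_2,e_1,e_2)$, all other $(e_i,e_j,e_k)$ being zero. Canonical enveloping Lie algebra: an enveloping pair of a Bol algebra $\mathfrak{B}$ consists of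 a finite-dimensional real Lie algebra $\mathfrak{G}$ containing $\mathfrak{B}$ as a vector subspace and a subalgebra $\mathfrak{h}$ with $\mathfrak{G}=\mathfrak{B}\oplus\mathfrak{h}$ (direct sum of vector spaces), $[[\mathfrak{B},\mathfrak{B}],\mathfrak{B}]\subset\mathfrak{B}$, $x\cdot y$ equal to the projection of $[x,y]$ onto $\mathfrak{B}$ parallel to $\mathfrak{h}$, and $(x,y,z)=[[x,y],z]$. It is canonical if $\mathfrak{B}$ generates $\mathfrak{G}$ as a Lie algebra and $\mathfrak{h}$ contains no nonzero ideal of $\mathfrak{G}$. *)

(* Defs.v *)
From HB Require Import structures.
From mathcomp Require Import all_boot all_order all_algebra.
From mathcomp Require Import reals.
From mathcomp Require Import ring.

Set Implicit Arguments.
Unset Strict Implicit.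
Unset Printing Implicit Defensive.

Import Order.TTheory GRing.Theory Num.Theory.
Local Open Scope ring_scope.

HB.mixin Record Vector_isBolAlgebra (R : fieldType) V of Vector R V := {
  bol_mul : V -> V -> V;
  bol_triple : V -> V -> V -> V;
  bol_mul_linearl : forall y, linear (fun x => bol_mul x y);
  bol_mul_linearr : forall x, linear (fun y => bol_mul x y);
  bol_triple_linear1 : forall y z, linear (fun x => bol_triple x y z);
  bol_triple_linear2 : forall x z, linear (fun y => bol_triple x y z);
  bol_triple_linear3 : forall x y, linear (fun z => bol_triple x y z);
  bol_mulxx : forall x, bol_mul x x = 0;
  bol_triplexx : forall x y, bol_triple x x y = 0;
  bol_triple_cyclic : forall x y z,
    bol_triple x y z + bol_triple y z x + bol_triple z x y = 0;
  bol_triple_der : forall x y z xi eta,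
    bol_triple x y (bol_triple z xi eta) =
      bol_triple (bol_triple x y z) xi eta
      + bol_triple z (bol_triple x y xi) eta
      + bol_triple z xi (bol_triple x y eta);
  bol_mul_pseudo_der : forall x y z xi,
    bol_mul (bol_triple x y z) xi - bol_mul (bol_triple x y xi) z
    + bol_triple z xi (bol_mul x y) - bol_triple x y (bol_mul z xi)
    + bol_mul (bol_mul x y) (bol_mul z xi) = 0
}.

#[short(type="bolAlgType")]
HB.structure Definition BolAlgebra (R : fieldType) :=
  {V of Vector R V & Vector_isBolAlgebra R V}.

Definition bol_isomorphic (R : fieldType) (B B' : bolAlgType R) : Prop :=
  exists f : {linear B -> B'},
    [/\ bijective f,
        forall x y, f (bol_mul x y) = bol_mul (f x) (f y) &
        forall x y z, f (bol_triple x y z) = bol_triple (f x) (f y) (f z)].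

HB.mixin Record Vector_isLieAlgebra (R : fieldType) V of Vector R V := {
  lie : V -> V -> V;
  lie_linearl : forall y, linear (fun x => lie x y);
  lie_linearr : forall x, linear (fun y => lie x y);
  liexx : forall x, lie x x = 0;
  lie_jacobi : forall x y z,
    lie (lie x y) z + lie (lie y z) x + lie (lie z x) y = 0
}.

#[short(type="lieAlgType")]
HB.structure Definition LieAlgebra (R : fieldType) :=
  {V of Vector R V & Vector_isLieAlgebra R V}.

Section LieSubspaces.
Variables (R : fieldType) (G : lieAlgType R).
Implicit Types S I : {vspace G}.

Definition lie_subalgebra S : Prop :=
  forall x y, x \in S -> y \in S -> lie x y \in S.

Definition lie_ideal I : Prop :=
  forall x y, y \in I -> lie x y \in I.

Definition lie_generates S : Prop :=
  forall S' : {vspace G}, lie_subalgebra S' -> (S <= S')%VS -> S' = fullv.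

End LieSubspaces.

(* The inclusion of B into G as a vector subspace is an injective linear map
   iota, so that the copy of B inside G is limg iota. *)
Section Enveloping.
Variables (R : fieldType) (B : bolAlgType R) (G : lieAlgType R).

Definition enveloping_pair (iota : 'Hom(B, G)) (h : {vspace G}) : Prop :=
  [/\ lker iota = 0%VS,
      lie_subalgebra h,
      (limg iota + h = fullv)%VS /\ (limg iota :&: h = 0)%VS &
   [/\ forall x y z, lie (lie (iota x) (iota y)) (iota z) \in limg iota,
       forall x y,
         iota (bol_mul x y) = daddv_pi (limg iota) h (lie (iota x) (iota y)) &
       forall x y z,
         iota (bol_triple x y z) = lie (lie (iota x) (iota y)) (iota z)]].

Definition canonical_enveloping_pair (iota : 'Hom(B, G)) (h : {vspace G}) :
    Prop :=
  [/\ enveloping_pair iota h,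
      lie_generates (limg iota) &
      forall I : {vspace G}, lie_ideal I -> (I <= h)%VS -> I = 0%VS].

End Enveloping.

(* The canonical enveloping pair of a Bol algebra is unique up to isomorphism,
   so that "the" canonical enveloping algebra has dimension n iff some
   canonical enveloping pair has dimension n. *)
Definition canonical_enveloping_dim (R : fieldType) (B : bolAlgType R)
    (n : nat) : Prop :=
  exists (G : lieAlgType R) (iota : 'Hom(B, G)) (h : {vspace G}),
    canonical_enveloping_pair iota h /\ \dim {:G} = n.

(* Indices start at 0: e`_0, e`_1, e`_2 stand for e_1, e_2, e_3. *)
Definition typeIIIplus (R : fieldType) (B : bolAlgType R) : Prop :=
  exists2 e : 3.-tuple B, basis_of fullv e &
    forall i j k : 'I_3,
      bol_triple e`_i e`_j e`_k =
        match val i, val j, val k with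
        | 0%N, 1%N, 1%N => - e`_0
        | 1%N, 0%N, 1%N => e`_0
        | _, _, _ => 0
        end.

(* The Bol algebra on R^3 (with standard basis e_1, e_2, e_3) in which
   e_1.e_2 = u and (e_1,e_2,e_2) = -e_1 are, up to skew-symmetry in the first
   two arguments, the only nonzero operations on basis vectors; see bolIII_mulE
   and bolIII_tripleE below. It is a Bol algebra for every u. *)
Section BolIII.
Variable R : fieldType.

Definition bolIII (u : 'rV[R]_3) : Type := 'rV[R]_3.

HB.instance Definition _ (u : 'rV[R]_3) := Vector.copy (bolIII u) 'rV[R]_3.

Definition ebasis (i : 'I_3) : 'rV[R]_3 := delta_mx 0 i.
Definition e1 : 'rV[R]_3 := ebasis 0.
Definition e2 : 'rV[R]_3 := ebasis 1.
Definition e3 : 'rV[R]_3 := ebasis 2%:R.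

Definition wedge12 (x y : 'rV[R]_3) : R := x 0 0 * y 0 1 - x 0 1 * y 0 0.

Definition bolIII_mul (u x y : 'rV[R]_3) : 'rV[R]_3 := wedge12 x y *: u.

Definition bolIII_triple (x y z : 'rV[R]_3) : 'rV[R]_3 :=
  (wedge12 x y * z 0 1) *: (- e1).

Ltac bolIII_tac :=
  repeat move=> ?; apply/rowP => ?;
  rewrite /bolIII_mul /bolIII_triple /wedge12 /e1 /ebasis !mxE /=; ring.

Fact bolIII_mul_linearl u y : linear (fun x => bolIII_mul u x y).
Proof. bolIII_tac. Qed.
Fact bolIII_mul_linearr u x : linear (fun y => bolIII_mul u x y).
Proof. bolIII_tac. Qed.
Fact bolIII_triple_linear1 y z : linear (fun x => bolIII_triple x y z).
Proof. bolIII_tac. Qed.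
Fact bolIII_triple_linear2 x z : linear (fun y => bolIII_triple x y z).
Proof. bolIII_tac. Qed.
Fact bolIII_triple_linear3 x y : linear (fun z => bolIII_triple x y z).
Proof. bolIII_tac. Qed.
Fact bolIII_mulxx u x : bolIII_mul u x x = 0.
Proof. bolIII_tac. Qed.
Fact bolIII_triplexx x y : bolIII_triple x x y = 0.
Proof. bolIII_tac. Qed.
Fact bolIII_triple_cyclic x y z :
  bolIII_triple x y z + bolIII_triple y z x + bolIII_triple z x y = 0.
Proof. bolIII_tac. Qed.
Fact bolIII_triple_der x y z xi eta :
  bolIII_triple x y (bolIII_triple z xi eta) =
    bolIII_triple (bolIII_triple x y z) xi eta
    + bolIII_triple z (bolIII_triple x y xi) eta
    + bolIII_triple z xi (bolIII_triple x y eta).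
Proof. bolIII_tac. Qed.
Fact bolIII_mul_pseudo_der u x y z xi :
  bolIII_mul u (bolIII_triple x y z) xi - bolIII_mul u (bolIII_triple x y xi) z
  + bolIII_triple z xi (bolIII_mul u x y)
  - bolIII_triple x y (bolIII_mul u z xi)
  + bolIII_mul u (bolIII_mul u x y) (bolIII_mul u z xi) = 0.
Proof. bolIII_tac. Qed.

HB.instance Definition _ (u : 'rV[R]_3) :=
  Vector_isBolAlgebra.Build R (bolIII u)
    (bolIII_mul_linearl u) (bolIII_mul_linearr u)
    bolIII_triple_linear1 bolIII_triple_linear2 bolIII_triple_linear3
    (bolIII_mulxx u) bolIII_triplexx bolIII_triple_cyclic
    bolIII_triple_der (bolIII_mul_pseudo_der u).

Fact bolIII_mulE u (i j : 'I_3) :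
  bol_mul (ebasis i : bolIII u) (ebasis j) =
    match val i, val j with
    | 0%N, 1%N => u
    | 1%N, 0%N => - u
    | _, _ => 0
    end.
Proof.
rewrite /bol_mul /= /bolIII_mul /wedge12 /ebasis !mxE.
by case: i => [[|[|[|i]]] ?] //; case: j => [[|[|[|j]]] ?] //;
  rewrite /= ?(mulr0, mulr1, mul0r, subr0, sub0r, oppr0, scale0r, scale1r, scaleN1r).
Qed.

Fact bolIII_tripleE u (i j k : 'I_3) :
  bol_triple (ebasis i : bolIII u) (ebasis j) (ebasis k) =
    match val i, val j, val k with
    | 0%N, 1%N, 1%N => - e1
    | 1%N, 0%N, 1%N => e1
    | _, _, _ => 0
    end.
Proof.
rewrite /bol_triple /= /bolIII_triple /wedge12 /ebasis !mxE.
by case: i => [[|[|[|i]]] ?] //; case: j => [[|[|[|j]]] ?] //;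
  case: k => [[|[|[|k]]] ?] //;
  rewrite /= ?(mulr0, mulr1, mul0r, subr0, sub0r, oppr0, scale0r, scale1r, scaleN1r,
               opprK).
Qed.

End BolIII.

(* Each listed algebra is determined by the product e_1.e_2, see listIII_e1e2;
   the parameter x is required to be nonnegative by listIII_valid. *)
Inductive listIII (R : Type) : Type :=
  | ListI
  | ListII of R
  | ListIII of R.
Arguments ListI {R}.

Section ListIII.
Variable R : realType.

Definition listIII_valid (c : listIII R) : bool :=
  match c with
  | ListI => true
  | ListII x | ListIII x => 0 <= x
  end.

Definition listIII_e1e2 (c : listIII R) : 'rV[R]_3 :=
  match c with
  | ListI => - e2 R
  | ListII x => - (x *: e1 R)
  | ListIII x => - (x *: e1 R) - e3 R
  end.

Definition listIII_alg (c : listIII R) : bolAlgType R :=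
  bolIII (listIII_e1e2 c).

End ListIII.

(* Main.v *)
From HB Require Import structures.
From mathcomp Require Import all_boot all_order all_algebra.
From mathcomp Require Import reals.
From mathcomp Require Import ring lra.
Require Import Defs.

Set Implicit Arguments.
Unset Strict Implicit.
Unset Printing Implicit Defensive.

Import Order.TTheory GRing.Theory Num.Theory.
Local Open Scope ring_scope.

(** The trilinear operation pins down almost everything. Let a, b, c be the
    images in the enveloping algebra G of a basis of B in which the triple
    product is of Type III+, and let E = [a, b], so that ad E sends b to -a and
    kills a and c. The brackets [a, c] and [b, c] commute with a, b and c, as
    the triple product vanishes on them. If E were in span(a, b, c), expanding
    [E, b] = -a twice would give E = p a with p^2 = -1, which is impossible over
    the reals; this is where the sign of the type matters. Hence in dimension 4
    the vectors a, b, c, E form a basis of G, and comparing coordinates in the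
    relations that express the centrality of [a, c] and [b, c] shows that both
    brackets vanish (third_vector_central). Projecting to B gives
    e_1.e_3 = e_2.e_3 = 0, so B is the algebra bolIII u for u = e_1.e_2
    (typeIIIplus_bolIII).

    It remains to classify the vectors u. An isomorphism between two algebras
    bolIII preserves the line of e_1, which is spanned by the triple products,
    and the line of e_3, which is the common kernel of the triple product in its
    three arguments. It is therefore given by e_1 -> l e_1,
    e_2 -> m e_1 + e e_2 + n e_3, e_3 -> k e_3, and preserving
    (e_1, e_2, e_2) = -e_1 amounts to e^2 = 1. Such a map carries bolIII u to
    bolIII u' exactly when it maps u to l e u' (bolIII_isoP). The orbits are
    read off from this: if u has a component on e_2, the map can be chosen to
    send u to a multiple of e_2; otherwise only the absolute value of the first
    coordinate and the vanishing of the third one are invariant. *)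

(** * Isomorphisms between the algebras bolIII *)

Section Triangular.
Variable R : fieldType.

Lemma row3P (u v : 'rV[R]_3) :
  u 0 0 = v 0 0 -> u 0 1 = v 0 1 -> u 0 2%:R = v 0 2%:R -> u = v.
Proof.
move=> h0 h1 h2; apply/rowP => -[[|[|[|i]]] lti] //.
- by rewrite (_ : Ordinal lti = 0) //; apply: val_inj.
- by rewrite (_ : Ordinal lti = 1) //; apply: val_inj.
- by rewrite (_ : Ordinal lti = 2%:R) //; apply: val_inj.
Qed.

Lemma row3E (v : 'rV[R]_3) :
  v = v 0 0 *: e1 R + v 0 1 *: e2 R + v 0 2%:R *: e3 R.
Proof. by apply: row3P; rewrite !mxE /=; ring. Qed.

Definition triangular_map (l m e n k : R) (v : 'rV[R]_3) : 'rV[R]_3 :=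
  (l * v 0 0 + m * v 0 1) *: e1 R + (e * v 0 1) *: e2 R
  + (n * v 0 1 + k * v 0 2%:R) *: e3 R.

Lemma triangular_map_linear l m e n k : linear (triangular_map l m e n k).
Proof.
by move=> a x y; rewrite /triangular_map; apply: row3P; rewrite !mxE /=; ring.
Qed.

HB.instance Definition _ l m e n k :=
  GRing.isLinear.Build R 'rV[R]_3 'rV[R]_3 _ (triangular_map l m e n k)
    (triangular_map_linear l m e n k).

Lemma triangular_map_bij l m e n k :
  l != 0 -> e != 0 -> k != 0 -> bijective (triangular_map l m e n k).
Proof.
move=> l0 e0 k0.
exists (triangular_map l^-1 (- (m / (l * e))) e^-1 (- (n / (e * k))) k^-1) => v;
  by apply: row3P; rewrite !mxE /= ?(mulr0, mulr1, addr0, add0r);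
    field; rewrite ?l0 ?e0 ?k0.
Qed.

(** Preserving the triple product forces the triangular shape and e^2 = 1; the
    equation on u is then the image of e_1.e_2 = u. *)
Lemma bolIII_isoP (u u' : 'rV[R]_3) :
  bol_isomorphic (bolIII u) (bolIII u') <->
  exists l m e n k : R, [/\ l != 0, e ^+ 2 = 1, k != 0 &
    triangular_map l m e n k u = (l * e) *: u'].
Proof.
split.
- case=> f [/bij_inj f_inj f_mul f_triple].
  have f_neq0 (v : 'rV[R]_3) : v != 0 -> f v != 0.
    by apply: contra_neq => fv0; apply: f_inj; rewrite fv0 linear0.
  have e1_neq0 : e1 R != 0.
    by apply/eqP => /rowP/(_ 0); rewrite !mxE /= => /eqP; rewrite oner_eq0.
  have e3_neq0 : e3 R != 0.
    by apply/eqP => /rowP/(_ 2%:R); rewrite !mxE /= => /eqP; rewrite oner_eq0.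
  set a : 'rV[R]_3 := f (e1 R); set b : 'rV[R]_3 := f (e2 R).
  set c : 'rV[R]_3 := f (e3 R).
  have fE (v : 'rV[R]_3) :
      f v = v 0 0 *: a + v 0 1 *: b + v 0 2%:R *: c :> 'rV[R]_3.
    by rewrite {1}(row3E v) !linearD !linearZ.
  (* All triple products are multiples of e_1, so every instance of the
     hypothesis on f reduces to one identity between scalars. *)
  have tripleE (x y z : 'rV[R]_3) : (wedge12 x y * z 0 1) *: a
      = (wedge12 (f x) (f y) * (f z : 'rV[R]_3) 0 1) *: e1 R.
    have := f_triple x y z; rewrite /bol_triple /= /bolIII_triple.
    by rewrite linearZ linearN /= !scalerN => /oppr_inj.
  have := tripleE (e1 R) (e2 R) (e2 R).
  rewrite -/a -/b {1}/wedge12 !mxE /= ?(mulr0, mulr1, subr0) scale1r => aE.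
  have a1 : a 0 1 = 0 by rewrite aE !mxE /= mulr0.
  have a2 : a 0 2%:R = 0 by rewrite aE !mxE /= mulr0.
  have a0 : a 0 0 != 0.
    apply: contra_neq (f_neq0 _ e1_neq0) => a0.
    by apply: row3P; rewrite -/a ?a0 ?a1 ?a2 mxE.
  have b_sqr : b 0 1 ^+ 2 = 1.
    apply: (mulfI a0); rewrite mulr1 {2}aE !mxE /= /wedge12 a1; ring.
  have b1 : b 0 1 != 0.
    by apply: contra_eq_neq b_sqr => ->; rewrite expr0n /= eq_sym oner_eq0.
  (* (e_1, e_2, e_3) = 0 and (e_3, e_2, e_2) = 0 force f e_3 into the line of
     e_3. *)
  have c1 : c 0 1 = 0.
    have /rowP/(_ 0) := tripleE (e1 R) (e2 R) (e3 R).
    rewrite -/a -/b -/c /wedge12 !mxE /= ?(mulr0, mulr1, mul0r, subr0) a1 mul0r.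
    by rewrite subr0 => /esym/eqP; rewrite !mulf_eq0 (negPf a0) (negPf b1) => /eqP.
  have c0 : c 0 0 = 0.
    have /rowP/(_ 0) := tripleE (e3 R) (e2 R) (e2 R).
    rewrite -/b -/c /wedge12 !mxE /= ?(mulr0, mulr1, mul0r, subr0) c1 mul0r.
    by rewrite subr0 => /esym/eqP; rewrite !mulf_eq0 (negPf b1) !orbF => /eqP.
  have c2 : c 0 2%:R != 0.
    apply: contra_neq (f_neq0 _ e3_neq0) => c2.
    by apply: row3P; rewrite -/c ?c0 ?c1 ?c2 mxE.
  exists (a 0 0), (b 0 0), (b 0 1), (b 0 2%:R), (c 0 2%:R); split=> //.
  have := f_mul (e1 R) (e2 R); rewrite /bol_mul /= /bolIII_mul -/a -/b.
  rewrite {1 2}/wedge12 !mxE /= ?(mulr0, mulr1, mul0r, subr0) scale1r a1 mul0r.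
  rewrite subr0 => <-; rewrite fE.
  by apply: row3P; rewrite !mxE /= ?a1 ?a2 ?c0 ?c1; ring.
- case=> l [m [e [n [k [l0 ee k0 gu]]]]].
  have e0 : e != 0.
    by apply: contra_eq_neq ee => ->; rewrite expr0n /= eq_sym oner_eq0.
  exists (triangular_map l m e n k : {linear 'rV[R]_3 -> 'rV[R]_3}); split.
  + exact: triangular_map_bij.
  + move=> x y; rewrite /bol_mul /= /bolIII_mul linearZ /= gu scalerA.
    by congr (_ *: _); rewrite /wedge12 !mxE /=; ring.
  + move=> x y z; rewrite /bol_triple /= /bolIII_triple.
    apply: row3P; rewrite /wedge12 !mxE /=; ring: ee.
Qed.
End Triangular.

(** * Normal forms of e_1.e_2 *)

Section NormalForms.
Variable R : realType.
Implicit Types (u : 'rV[R]_3) (c : listIII R).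

(** The free entries m and n clear u against its e_2 component. Without such a
    component, k normalizes the third coordinate, and l cancels from the equation
    on the first one, which can only be changed by the sign e. *)
Lemma bolIII_normal_form u :
  exists2 c, listIII_valid c & bol_isomorphic (bolIII u) (listIII_alg c).
Proof.
have [u1|u1] := eqVneq (u 0 1) 0; last first.
  exists ListI => //; apply/bolIII_isoP.
  exists (- u 0 1), (u 0 0), 1, (- u 0 2%:R / u 0 1), 1.
  split; rewrite ?oppr_eq0 ?expr1n ?oner_eq0 //.
  by apply: row3P; rewrite !mxE /=; field.
pose e : R := if 0 <= u 0 0 then -1 else 1.
have ee : e ^+ 2 = 1 by rewrite /e; case: ifP => _; rewrite ?sqrrN expr1n.
have u0 : u 0 0 = - (e * `|u 0 0|).
  by rewrite /e; case: ger0P => _; ring.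
have [u2|u2] := eqVneq (u 0 2%:R) 0.
  exists (ListII `|u 0 0|) => /=; first exact: normr_ge0.
  apply/bolIII_isoP; exists 1, 0, e, 0, 1; split; rewrite ?oner_eq0 //.
  by apply: row3P; rewrite !mxE /= ?u1 ?u2 1?{1}u0; ring.
exists (ListIII `|u 0 0|) => /=; first exact: normr_ge0.
have e0 : e != 0 by rewrite -sqrf_eq0 ee oner_eq0.
apply/bolIII_isoP; exists 1, 0, e, 0, (- (e / u 0 2%:R)).
split; rewrite ?oner_eq0 ?oppr_eq0 ?mulf_neq0 ?invr_eq0 //.
by apply: row3P; rewrite !mxE /= ?u1 1?{1}u0; field.
Qed.

(** A triangular map multiplies the second coordinate by e, so case (i) is
    isolated; on vectors without this coordinate the third one is multiplied by
    k, which separates (ii) from (iii), and the parameters x and x' satisfy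
    x = e x' with e = 1 or e = -1. *)
Lemma normal_form_unique c c' :
  listIII_valid c -> listIII_valid c' ->
  bol_isomorphic (listIII_alg c) (listIII_alg c') -> c = c'.
Proof.
move=> vc vc' /bolIII_isoP [l [m [e [n [k [l0 ee k0 /rowP gu]]]]]].
have e0 : e != 0 by rewrite -sqrf_eq0 ee oner_eq0.
have eN (x x' : R) : 0 <= x -> 0 <= x' -> x = e * x' -> x = x'.
  move=> x0 x'0 xE; rewrite -(ger0_norm x0) xE normrM (ger0_norm x'0).
  by move/eqP: ee; rewrite sqrf_eq1 => /orP[]/eqP->; rewrite ?normrN normr1 mul1r.
have le0 : l * e != 0 by rewrite mulf_neq0.
move: (gu 0) (gu 1) (gu 2%:R) => {gu}.
case: c vc => [|x|x] /= vc; case: c' vc' => [|x'|x'] /= vc'; rewrite !mxE /=;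
  rewrite ?(oppr0, mulr0, mulr1, mulrN1, addr0, add0r) => g0 g1 g2 //.
- by case/eqP: e0; lra.
- by case/eqP: e0; lra.
- by case/eqP: le0; lra.
- by congr ListII; apply: eN => //; apply: (mulfI l0); lra.
- by case/eqP: le0; lra.
- by case/eqP: le0; lra.
- by case/eqP: k0; lra.
- by congr ListIII; apply: eN => //; apply: (mulfI l0); lra.
Qed.
End NormalForms.

(** * Expansion of bilinear maps *)

Section Bilinear.
Variables (R : fieldType) (V W : vectType R).

Lemma linear_comb4 (f : V -> W) : linear f ->
  forall a b c d (x y z t : R), f (x *: a + y *: b + z *: c + t *: d)
    = x *: f a + y *: f b + z *: f c + t *: f d.
Proof.
move=> lf a b c d x y z t.
have f0 : f 0 = 0 by have := lf (-1) 0 0; rewrite scaler0 addr0 scaleN1r addNr.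
by rewrite -!addrA !lf -[t *: d]addr0 lf f0 addr0.
Qed.

Lemma linear_comb3 (f : V -> W) : linear f ->
  forall a b c (x y z : R),
    f (x *: a + y *: b + z *: c) = x *: f a + y *: f b + z *: f c.
Proof.
move=> lf a b c x y z; have := linear_comb4 lf a b c 0 x y z 0.
by rewrite !scale0r !addr0.
Qed.

Variable m : V -> V -> W.
Hypotheses (ml : forall y, linear (m^~ y)) (mr : forall x, linear (m x)).
Hypothesis mxx : forall x, m x x = 0.

Lemma alternatingC x y : m x y = - m y x.
Proof.
apply/eqP; rewrite -addr_eq0; have := mxx (1 *: x + 1 *: y + 0 *: 0).
rewrite (linear_comb3 (ml _)) !(linear_comb3 (mr _)) !mxx.
by rewrite !scale0r !scaler0 !scale1r !addr0 add0r => ->.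
Qed.

Lemma alternating_comb3 a b c (x y z x' y' z' : R) :
  m (x *: a + y *: b + z *: c) (x' *: a + y' *: b + z' *: c)
  = (x * y' - y * x') *: m a b + (x * z' - z * x') *: m a c
    + (y * z' - z * y') *: m b c.
Proof.
rewrite (linear_comb3 (ml _)) !(linear_comb3 (mr _)) !mxx.
rewrite (alternatingC b a) (alternatingC c a) (alternatingC c b).
rewrite !scaler0 !addr0 !add0r !scalerDr !scalerN !scalerA !scalerBl.
set A := m a b; set B := m a c; set C := m b c.
by rewrite !addrA [LHS](ACl (1*3*2*5*4*6)%AC).
Qed.

End Bilinear.

(** * The enveloping Lie algebra of dimension 4 *)

Section Lie.
Variables (R : realType) (G : lieAlgType R) (a b c : G).

Let E := lie a b.
Let comb (p q r w : R) := p *: a + q *: b + r *: c + w *: E.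

Let lieC := alternatingC (@lie_linearl R G) (@lie_linearr R G) (@liexx R G).

Let lie0l (x : G) : lie 0 x = 0.
Proof.
have := linear_comb3 (lie_linearl x) 0 0 0 0 0 0.
by rewrite !scale0r !addr0.
Qed.

Hypotheses (Ea : lie E a = 0) (Eb : lie E b = - a) (Ec : lie E c = 0).
Hypothesis ac_central :
  [/\ lie (lie a c) a = 0, lie (lie a c) b = 0 & lie (lie a c) c = 0].
Hypothesis bc_central :
  [/\ lie (lie b c) a = 0, lie (lie b c) b = 0 & lie (lie b c) c = 0].
Hypothesis abc_free : free [:: a; b; c].

Let a_neq0 : a != 0.
Proof. by apply: contraTneq abc_free => ->; rewrite free_cons mem0v. Qed.

(** If E = p a + q b + r c, then [E, b] = -a reads p E - r [b, c] = -a. Bracketing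
    once more with b removes the central term and leaves E = p a, whence
    (p^2 + 1) a = 0. *)
Lemma bracket_notin_span : E \notin <<[:: a; b; c]>>%VS.
Proof.
apply/negP; rewrite !span_cons span_nil addv0.
case/memv_addP => ? /vlineP[p ->] [?] /memv_addP[? /vlineP[q ->]] [? /vlineP[r ->] ->].
rewrite -/E addrA => EE.
have [_ bcb _] := bc_central.
have ElieB : p *: E - r *: lie b c = - a.
  rewrite -Eb {2}EE (linear_comb3 (lie_linearl b)) liexx scaler0 addr0.
  by rewrite (lieC c) scalerN.
have Epa : E = p *: a.
  have := linear_comb3 (lie_linearl b) E (lie b c) 0 p (- r) 0.
  rewrite scale0r addr0 scaleNr ElieB bcb Eb scaler0 scale0r !addr0 scalerN.
  have := linear_comb3 (lie_linearl b) a 0 0 (-1) 0 0.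
  by rewrite !scale0r !addr0 !scaleN1r => -> /oppr_inj.
have : (p ^+ 2 + 1) *: a = 0.
  have := Eb; rewrite {1}Epa.
  have := linear_comb3 (lie_linearl b) a 0 0 p 0 0.
  rewrite !scale0r !addr0 => ->; rewrite -/E Epa scalerA => pp.
  by rewrite scalerDl scale1r expr2 pp addNr.
move/eqP; rewrite scaler_eq0 (negPf a_neq0) orbF => /eqP pp.
by have := sqr_ge0 p; lra.
Qed.

Hypothesis dimG : \dim {:G} = 4%N.

Let X := [tuple a; b; c; E].

Lemma bracket_basis : basis_of fullv X.
Proof.
have Xperm : perm_eq X (E :: [:: a; b; c]).
  by rewrite (perm_catC [:: a; b; c] [:: E]).
rewrite basisEfree subvf size_tuple dimG leqnn andbT /=.
by rewrite (perm_free Xperm) free_cons bracket_notin_span abc_free.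
Qed.

Let combE x : exists p q r w, x = comb p q r w.
Proof.
have := coord_basis bracket_basis (memvf x); rewrite !big_ord_recl big_ord0 addr0.
rewrite /= !addrA => xE; do 4!eexists; exact: xE.
Qed.

Let comb_inj p q r w p' q' r' w' : comb p q r w = comb p' q' r' w' ->
  [/\ p = p', q = q', r = r' & w = w'].
Proof.
have combS x y z t :
    comb x y z t = \sum_(i < 4) [:: x; y; z; t]`_i *: X`_i.
  by rewrite !big_ord_recl big_ord0 addr0 /= !addrA.
rewrite !combS => eqc.
have co (i : 'I_4) : [:: p; q; r; w]`_i = [:: p'; q'; r'; w']`_i.
  have fX := basis_free bracket_basis.
  by have := congr1 (coord X i) eqc; rewrite !coord_sum_free.
by split; [exact: (co 0) | exact: (co 1) | exact: (co 2%:R) | exact: (co 3%:R)].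
Qed.

(** Write z = [a, c] as p a + q b + r c + w E. Then [z, E] = 0 gives q = 0, while
    [z, a] = 0 and [z, c] = 0 read r z = 0 and p z = 0, and [z, b] = 0 kills w.
    For z = [b, c] one has q = 0 again, and [z, b] = 0 reads r z = p E - w a;
    its c coordinate is r^2 = 0, which kills the other two. *)
Lemma third_vector_central : lie a c = 0 /\ lie b c = 0.
Proof.
have lie_comb p q r w x : lie (comb p q r w) x
    = p *: lie a x + q *: lie b x + r *: lie c x + w *: lie E x.
  exact: (linear_comb4 (lie_linearl x)).
have aE : lie a E = 0 by rewrite lieC Ea oppr0.
have bE : lie b E = a by rewrite lieC Eb opprK.
have cE : lie c E = 0 by rewrite lieC Ec oppr0.
have central_E z : lie z a = 0 -> lie z b = 0 -> lie z E = 0.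
  move=> za zb; have := lie_jacobi a b z.
  by rewrite (lieC b z) zb oppr0 za !lie0l !addr0 -/E lieC => /eqP; rewrite oppr_eq0 => /eqP.
(* As [a, E] = [c, E] = 0 and [b, E] = a, this is the equation q a = 0. *)
have no_b p q r w : lie (comb p q r w) a = 0 -> lie (comb p q r w) b = 0 -> q = 0.
  move=> za zb; have := central_E _ za zb.
  rewrite lie_comb aE bE cE liexx !scaler0 add0r !addr0 => /eqP.
  by rewrite scaler_eq0 (negPf a_neq0) orbF => /eqP.
have ac0 : lie a c = 0.
  apply/eqP/negPn/negP => z0; have [za zb zc] := ac_central.
  have [p [q [r [w zE]]]] := combE (lie a c).
  have q0 : q = 0 by apply: (no_b p q r w); rewrite -zE.
  have r0 : r = 0.
    move: za; rewrite {1}zE lie_comb liexx q0 Ea scale0r !scaler0 !add0r addr0.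
    by rewrite lieC scalerN => /eqP; rewrite oppr_eq0 scaler_eq0 (negPf z0) orbF => /eqP.
  have p0 : p = 0.
    move: zc; rewrite {1}zE lie_comb liexx q0 Ec scale0r !scaler0 !addr0.
    by move=> /eqP; rewrite scaler_eq0 (negPf z0) orbF => /eqP.
  have w0 : w = 0.
    move: zb; rewrite {1}zE lie_comb p0 q0 r0 Eb !scale0r !add0r scalerN.
    by move=> /eqP; rewrite oppr_eq0 scaler_eq0 (negPf a_neq0) orbF => /eqP.
  by move: z0; rewrite zE p0 q0 r0 w0 /comb !scale0r !addr0 eqxx.
split=> //; have [za zb zc] := bc_central.
have [p [q [r [w zE]]]] := combE (lie b c).
have q0 : q = 0 by apply: (no_b p q r w); rewrite -zE.
have rz : r *: lie b c = comb (- w) 0 0 p.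
  move: zb; rewrite {1}zE lie_comb -/E liexx q0 Eb (lieC c b) scaler0 addr0.
  rewrite !scalerN /comb !scale0r !addr0 scaleNr => /eqP.
  by rewrite addrAC subr_eq0 => /eqP <-; rewrite addrC.
have /comb_inj[rp _ rr rw] : comb (r * p) 0 (r * r) (r * w) = comb (- w) 0 0 p.
  by rewrite -rz zE q0 /comb !scale0r !addr0 !scalerDr !scalerA.
have r0 : r = 0 by apply/eqP; rewrite -sqrf_eq0 expr2 rr.
have p0 : p = 0 by rewrite -rw r0 mul0r.
have w0 : w = 0 by apply: oppr_inj; rewrite -rp r0 mul0r oppr0.
by rewrite zE p0 q0 r0 w0 /comb !scale0r !addr0.
Qed.

End Lie.

(** * Coordinates on a Bol algebra of Type III+ *)

Section Coordinates.
Variables (R : fieldType) (B : bolAlgType R) (e : 3.-tuple B).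
Hypothesis e_basis : basis_of fullv e.

Definition row_coord (x : B) : 'rV[R]_3 := \row_i coord e i x.

Lemma row_coord_linear : linear row_coord.
Proof. by move=> k x y; apply/rowP => i; rewrite !mxE linearP. Qed.

HB.instance Definition _ :=
  GRing.isLinear.Build R B 'rV[R]_3 _ row_coord row_coord_linear.

Lemma row_coordK x :
  x = row_coord x 0 0 *: e`_0 + row_coord x 0 1 *: e`_1
      + row_coord x 0 2%:R *: e`_2.
Proof.
rewrite {1}(coord_basis e_basis (memvf x)) !big_ord_recl big_ord0 addr0 addrA.
by rewrite !mxE; do ?congr (_ + _); congr (coord e _ x *: _); apply: val_inj.
Qed.

Lemma row_coord_bij : bijective row_coord.
Proof.
exists (fun v : 'rV[R]_3 => \sum_i v 0 i *: e`_i) => [x|v].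
  rewrite [RHS](coord_basis e_basis (memvf x)).
  by apply: eq_bigr => i _; rewrite mxE.
by apply/rowP => i; rewrite mxE coord_sum_free ?(basis_free e_basis).
Qed.

(** Both operations are skew-symmetric in their first two arguments, hence
    functions of the three 2 x 2 minors of the coordinates; under the hypotheses
    only the minor wedge12 has a nonzero coefficient. *)
Lemma bolIII_of_basis :
  (forall i j k : 'I_3, bol_triple e`_i e`_j e`_k =
    match val i, val j, val k with
    | 0%N, 1%N, 1%N => - e`_0
    | 1%N, 0%N, 1%N => e`_0
    | _, _, _ => 0
    end) ->
  bol_mul e`_0 e`_2 = 0 -> bol_mul e`_1 e`_2 = 0 ->
  bol_isomorphic B (bolIII (row_coord (bol_mul e`_0 e`_1))).
Proof.
move=> tripleE m02 m12.
have rc0 : row_coord e`_0 = e1 R.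
  apply/rowP => i; rewrite !mxE (coord_free 0 _ (basis_free e_basis)).
  by rewrite eq_sym eqxx.
exists (row_coord : {linear B -> 'rV[R]_3}); split; first exact: row_coord_bij.
- move=> x y; rewrite {1}(row_coordK x) {1}(row_coordK y).
  rewrite (alternating_comb3 (@bol_mul_linearl _ B) (@bol_mul_linearr _ B)
             (@bol_mulxx _ B)).
  by rewrite m02 m12 !scaler0 !addr0 linearZ.
- move=> x y z.
  have ez i j : bol_triple e`_i e`_j z = row_coord z 0 0 *: bol_triple e`_i e`_j e`_0
     + row_coord z 0 1 *: bol_triple e`_i e`_j e`_1
     + row_coord z 0 2%:R *: bol_triple e`_i e`_j e`_2.
    by rewrite {1}(row_coordK z) (linear_comb3 (bol_triple_linear3 _ _)).
  rewrite {1}(row_coordK x) {1}(row_coordK y).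
  rewrite (alternating_comb3 (m := fun x y => bol_triple x y z)
    (fun y => bol_triple_linear1 y z) (fun x => bol_triple_linear2 x z)
    (fun x => bol_triplexx x z)).
  rewrite !ez.
  have T := tripleE.
  rewrite (T 0 1 0) (T 0 1 1) (T 0 1 2%:R) (T 0 2%:R 0) (T 0 2%:R 1).
  rewrite (T 0 2%:R 2%:R) (T 1 2%:R 0) (T 1 2%:R 1) (T 1 2%:R 2%:R) /=.
  by rewrite !scaler0 !add0r !addr0 !scaler0 !addr0 scalerA linearZ linearN /= rc0.
Qed.

End Coordinates.

Lemma bol_isomorphic_trans (R : fieldType) (B1 B2 B3 : bolAlgType R) :
  bol_isomorphic B1 B2 -> bol_isomorphic B2 B3 -> bol_isomorphic B1 B3.
Proof.
case=> f [f_bij fm ft] [g [g_bij gm gt]].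
exists (g \o f : {linear B1 -> B3}); split; first exact: bij_comp.
- by move=> x y; rewrite /= fm gm.
- by move=> x y z; rewrite /= ft gt.
Qed.

(** The products e_1.e_3 and e_2.e_3 are projections of brackets that vanish by
    third_vector_central. *)
Lemma typeIIIplus_bolIII (R : realType) (B : bolAlgType R) :
  typeIIIplus B -> canonical_enveloping_dim B 4%N ->
  exists u, bol_isomorphic B (bolIII u).
Proof.
case=> e e_basis T [G [iota [h [[[ker0 _ _ [_ projE tripleE]] _ _] dimG]]]].
exists (row_coord e (bol_mul e`_0 e`_1)).
have inj := lker0P (introT eqP ker0).
have lT i j k : lie (lie (iota e`_(i : 'I_3)) (iota e`_(j : 'I_3)))
    (iota e`_(k : 'I_3)) = iota (bol_triple e`_i e`_j e`_k).
  by rewrite tripleE.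
have [] := @third_vector_central R G (iota e`_0) (iota e`_1) (iota e`_2).
- by rewrite (lT 0 1 0) (T 0 1 0) linear0.
- by rewrite (lT 0 1 1) (T 0 1 1) linearN.
- by rewrite (lT 0 1 2%:R) (T 0 1 2%:R) linear0.
- by rewrite (lT 0 2%:R 0) (lT 0 2%:R 1) (lT 0 2%:R 2%:R) !T linear0.
- by rewrite (lT 1 2%:R 0) (lT 1 2%:R 1) (lT 1 2%:R 2%:R) !T linear0.
- have : basis_of (iota @: fullv)%VS (map iota e).
    by apply: limg_basis_of => //; rewrite ker0 capv0.
  move/basis_free; case: (e) => -[|? [|? [|? [|]]]] //=.
- exact: dimG.
move=> l02 l12; apply: bolIII_of_basis => //; apply: inj.
- by rewrite projE l02 !linear0.
- by rewrite projE l12 !linear0.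
Qed.

(** * Classification *)

Theorem mainTheorem7 (R : realType) :
  (forall B : bolAlgType R,
     \dim {:B} = 3%N ->
     typeIIIplus B ->
     canonical_enveloping_dim B 4%N ->
     exists2 c : listIII R, listIII_valid c &
       bol_isomorphic B (listIII_alg c)) /\
  (forall c c' : listIII R,
     listIII_valid c -> listIII_valid c' ->
     c <> c' ->
     ~ bol_isomorphic (listIII_alg c) (listIII_alg c')).
Proof.
split=> [B _ typeB dimB | c c' vc vc' neq /(normal_form_unique vc vc')//].
have [u Bu] := typeIIIplus_bolIII typeB dimB.
have [c vc uc] := bolIII_normal_form u.
by exists c => //; apply: bol_isomorphic_trans Bu uc.
Qed.
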